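(* Suppose the mechanism $M(D)=f(D)+Z$, where $D$ is the input dataset, $f(\cdot)$ is an $m$-dimensional function with $\ell^2$-sensitivity $\Delta_f\le 1$ and the noise is $Z\sim\mathcal{N}(0,\sigma_*^2)$ (in each coordinate, independently), is $(\epsilon,\delta)$-differentially private. Then the mechanism $M'(D)=f'(D)+Z'$, where $f'(\cdot)$ is also an $m$-dimensional function, $Z'=(z_1',\dots,z_m')^T$ and, for all $i\in\{1,\dots,m\}$, $z_i'\sim\mathcal{N}(0,\sigma_i^2)$ (independently over $i$), is also $(\epsilon,\delta)$-differentially private if $$\sum_{i=1}^{m}\frac{s_i^2}{\sigma_i^2}\le\frac{1}{\sigma_*^2},$$ where $s_i$ is the $\ell^2$-sensitivity of the $i$-th dimension of $f'(\cdot)$.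
   Context: The $\ell^2$-sensitivity of a function $f$ of datasets is $\Delta_f=\max_{D,D'}\|f(D)-f(D')\|_2$, where $D,D'$ are two datasets which differ in only one record; for the $i$-th dimension $f'_i$ of $f'$ this is $s_i=\max_{D,D'}|f'_i(D)-f'_i(D')|$. A randomized mechanism $M$ satisfies $(\epsilon,\delta)$-differential privacy if for any two neighboring datasets $D$ and $D'$ that differ only in one tuple, and for any possible subset of outputs $\mathcal{O}$ of $M$, $\Pr(M(D)\in\mathcal{O})\le e^{\epsilon}\cdot\Pr(M(D')\in\mathcal{O})+\delta$. *)

(* Defs.v *)
From HB Require Import structures.
From mathcomp Require Import all_boot all_order all_algebra.
From mathcomp Require Import all_classical all_reals all_analysis.

Set Implicit Arguments.
Unset Strict Implicit.
Unset Printing Implicit Defensive.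

Import Order.TTheory GRing.Theory Num.Theory.

Local Open Scope classical_set_scope.
Local Open Scope ring_scope.

(* The two conventions for "differing in only one record": one record is
   replaced by another one, or one record is added or removed. *)
Variant record_change := ReplaceRecord | AddOrRemoveRecord.

Section Datasets.
Variable X : Type.

Definition dataset := seq X.

Definition replaces_record (D D' : dataset) : Prop :=
  exists s t x y, [/\ x <> y, D = s ++ x :: t & D' = s ++ y :: t].

Definition adds_record (D D' : dataset) : Prop :=
  exists s t x, D = s ++ t /\ D' = s ++ x :: t.

Definition neighbors (c : record_change) (D D' : dataset) : Prop :=
  match c with
  | ReplaceRecord => replaces_record D D'
  | AddOrRemoveRecord => adds_record D D' \/ adds_record D' D
  end.

End Datasets.

Section Sensitivity.
Variables (R : realType) (X : Type) (c : record_change) (m : nat).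
Implicit Types f : dataset X -> m.-tuple R.

Definition l2dist (u v : m.-tuple R) : R :=
  Num.sqrt (\sum_(i < m) (tnth u i - tnth v i) ^+ 2).

(* Sensitivities are suprema in [0, +oo]: +oo when the differences are
   unbounded, and 0 (because of the added [set 0%E]) when there are no
   neighboring datasets. *)
Definition l2_sensitivity f : \bar R :=
  ereal_sup ([set 0%E] `|`
    [set e | exists D D', neighbors c D D' /\ e = (l2dist (f D) (f D'))%:E]).

Definition coord_sensitivity f (i : 'I_m) : \bar R :=
  ereal_sup ([set 0%E] `|`
    [set e | exists D D', neighbors c D D' /\
                          e = `|tnth (f D) i - tnth (f D') i|%:E]).

End Sensitivity.

Section Mechanisms.
Variables (R : realType) (d : measure_display) (Omega : measurableType d).
Variable P : probability Omega R.

(* The events "M(D) in O" are those with O measurable. *)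
Definition differentially_private (X : Type) (c : record_change)
    (d' : measure_display) (Y : measurableType d')
    (M : dataset X -> Omega -> Y) (epsilon delta : R) : Prop :=
  forall D D' : dataset X, neighbors c D D' ->
  forall O : set Y, measurable O ->
  (P (M D @^-1` O) <= (expR epsilon)%:E * P (M D' @^-1` O) + delta%:E)%E.

Definition additive_mechanism (X : Type) (m : nat)
    (f : dataset X -> m.-tuple R) (Z : 'I_m -> {RV P >-> R})
    (D : dataset X) (w : Omega) : m.-tuple R :=
  [tuple tnth (f D) i + Z i w | i < m].

Definition mutually_independent (m : nat) (Z : 'I_m -> {RV P >-> R}) : Prop :=
  forall (J : {set 'I_m}) (A : 'I_m -> set R),
  (forall i, measurable (A i)) ->
  (P (\bigcap_(i in [set` J]) (Z i @^-1` A i)) =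
   \prod_(i in J) P (Z i @^-1` A i))%E.

(* N(0, sigma ^+ 2): the second parameter of [normal_prob] is the standard
   deviation. The laws are compared on Borel sets only, since the values of a
   measure on non-measurable sets carry no meaning. *)
Definition centered_normal (Z : {RV P >-> R}) (sigma : R) : Prop :=
  forall A : set R, measurable A ->
  distribution P Z A = normal_prob 0 sigma A.

End Mechanisms.

(* Main.v *)
Require Import Defs.
From HB Require Import structures.
From mathcomp Require Import all_boot all_order all_algebra.
From mathcomp Require Import all_classical all_reals all_analysis.
From mathcomp Require Import measurable_realfun.

Set Implicit Arguments.
Unset Strict Implicit.
Unset Printing Implicit Defensive.

Import Order.TTheory GRing.Theory Num.Theory.

Local Open Scope classical_set_scope.
Local Open Scope ring_scope.

(* Rescaling coordinate i by sigma_star / sigma i turns f' into a query f of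
   sensitivity at most 1, by the hypothesis on the s_i, and turns the noise Z'
   into noise with the law of Z. Hence M' has, on every dataset, the law of the
   image of the private mechanism f + Z under a fixed measurable map, and
   differential privacy is stable under post-processing. *)

(** By uniqueness of Lebesgue measure it suffices to compare on half-open intervals, where the
    preimage of []a, b]] is []a / k, b / k]], of length [(b - a) / k]. *)
Lemma lebesgue_measure_dilation (R : realType) (k : R) (A : set R) :
  0 < k -> measurable A ->
  lebesgue_measure A = (k%:E * lebesgue_measure ( *%R k @^-1` A))%E.
Proof.
move=> k0 mA.
have mk : measurable_fun [set: measurableTypeR R]
    ( *%R k : _ -> measurableTypeR R) by exact: mulrl_measurable.
(* [push] takes the measurability of [ *%R k] as its argument. *)
pose push : {measure set (measurableTypeR R) -> \bar R} :=
  mscale (NngNum (ltW k0))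
    (pushforward lebesgue_measure ( *%R k : _ -> measurableTypeR R)).
rewrite [LHS](lebesgue_measure_unique (mu := push mk))// => _ [[a b]] _ <-.
rewrite /= /mscale /= /pushforward.
have -> : *%R k @^-1` `]a, b]%classic = `]a / k, b / k]%classic.
  apply/seteqP; split => x /=;
    by rewrite !in_itv/= ltr_pdivrMr// ler_pdivlMr// mulrC.
rewrite !lebesgue_measure_itv/= !lte_fin ltr_pM2r ?invr_gt0//.
case: ifPn => ab; last by rewrite mule0.
by rewrite -!EFinD -EFinM -mulrBl mulrC divfK// gt_eqF.
Qed.

(** Change of variables [x = k * y] in the integral of the density. *)
Lemma normal_prob_dilation (R : realType) (k s : R) (A : set R) :
  0 < k -> s != 0 -> measurable A ->
  normal_prob 0 (k * s) A = normal_prob 0 s ( *%R k @^-1` A).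
Proof.
move=> k0 s0 mA.
have mk : measurable_fun [set: measurableTypeR R]
    ( *%R k : _ -> measurableTypeR R) by exact: mulrl_measurable.
have mpdf t (D : set (measurableTypeR R)) :
    measurable_fun D (fun x => (normal_pdf 0 t x)%:E).
  by apply/measurable_EFinP/measurable_funTS; exact: measurable_normal_pdf.
have pdf0 t x : (0 <= (normal_pdf (0 : R) t x)%:E)%E.
  by rewrite lee_fin normal_pdf_ge0.
pose push : {measure set (measurableTypeR R) -> \bar R} :=
  pushforward lebesgue_measure ( *%R k : _ -> measurableTypeR R).
rewrite /normal_prob.
(* On the left, Lebesgue measure is replaced by [k] times its image under dilation, which moves the
   integral to the preimage of [A]. *)
rewrite (eq_measure_integral (mscale (NngNum (ltW k0)) (push mk))); last first.
  by move=> B mB _; exact: lebesgue_measure_dilation.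
rewrite ge0_integral_mscale// ge0_integral_pushforward//.
rewrite -ge0_integralZl//=; last 3 first.
- by rewrite -[X in measurable X]setTI; exact: mk.
- by apply: measurableT_comp => //; exact: mpdf.
- by rewrite lee_fin ltW.
(* Pointwise, [k] times the density of deviation [k * s] at [k * x] is the density of deviation [s]
   at [x]: the Jacobian [k] cancels against the normalizing constant. *)
apply: eq_integral => x _; rewrite -EFinM; congr (_%:E).
have kn0 : k != 0 by rewrite gt_eqF.
rewrite !normal_pdfE ?mulf_neq0// /normal_peak /normal_fun !subr0 !exprMn.
rewrite -[_ * pi]mulrA -[in LHS]mulrnAr sqrtrM ?sqr_ge0//.
rewrite sqrtr_sqr gtr0_norm//.
rewrite invfM mulrA mulVKf//; congr (_ * expR _).
by rewrite !mulNr -[k ^+ 2 * _ *+ 2]mulrnAr -mulf_div divff ?mul1r ?expf_neq0.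
Qed.

Section tuple_laws.
Context d (T : measurableType d) (m : nat).
Implicit Types (A : 'I_m -> set T).

Definition box A : set (m.-tuple T) := [set x | forall i, A i (tnth x i)].

Lemma boxE A : box A = \big[setI/setT]_(i < m) ((@tnth m T ^~ i) @^-1` A i).
Proof.
rewrite -bigcap_seq; apply/seteqP; split => x Ax i.
  by move=> _; exact: Ax.
by apply: Ax; rewrite /= mem_index_enum.
Qed.

Lemma measurable_box A : (forall i, measurable (A i)) -> measurable (box A).
Proof.
move=> mA; rewrite boxE; apply: bigsetI_measurable => i _.
by rewrite -[X in measurable X]setTI; exact: measurable_tnth.
Qed.

(** Boxes with measurable sides are stable under intersection and generate the product
    sigma-algebra, so the uniqueness theorem for measures applies. *)
Lemma measure_tuple_unique (R : realType)
    (P Q : probability (m.-tuple T) R) :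
  (forall A, (forall i, measurable (A i)) -> P (box A) = Q (box A)) ->
  forall O, measurable O -> P O = Q O.
Proof.
move=> PQ; pose G := [set B |
  exists2 A, forall i, measurable (A i) & B = box A].
have GT : G setT by exists (fun=> setT) => //; apply/seteqP; split.
apply: (measure_unique G (fun=> setT)) => //.
- apply/seteqP; split.
    apply: smallest_sub; first exact: smallest_sigma_algebra.
    rewrite -bigcup_seq => B [i _ [A mA <-]]; apply: sub_sigma_algebra.
    (* A cylinder over coordinate [i] is the box whose other sides are the whole space. *)
    exists (fun j => if j == i then A else setT).
      by move=> j; case: ifP.
    rewrite setTI; apply/seteqP; split => x /=.
      by move=> Ax j; case: eqP => // ->.
    by move=> /(_ i); rewrite eqxx.
  apply: smallest_sub; first exact: sigma_algebra_measurable.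
  by move=> _ [A mA ->]; exact: measurable_box.
- move=> _ _ [A mA ->] [B mB ->]; exists (fun i => A i `&` B i).
    by move=> i; exact: measurableI.
  apply/seteqP; split => x /=; first by move=> [Ax Bx] i; split.
  by move=> ABx; split=> i; case: (ABx i).
- by rewrite bigcup_const.
- by move=> _ [A mA ->]; exact: PQ.
- by move=> _; rewrite /= probability_setT ltry.
Qed.

End tuple_laws.

Section independent_noise.
Variables (R : realType) (m : nat).
Implicit Types (g : 'I_m -> R -> R).

Lemma measurable_tuple_noise d (Omega : measurableType d)
    (P : probability Omega R) (Z : 'I_m -> {RV P >-> R}) g :
  (forall i, measurable_fun setT (g i)) ->
  measurable_fun setT (fun w => [tuple g i (Z i w) | i < m]).
Proof.
move=> mg; apply/measurable_fun_tnthP => i.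
rewrite (_ : _ \o _ = g i \o Z i); last first.
  by apply/funext => w /=; rewrite tnth_mktuple.
exact: measurableT_comp.
Qed.

Lemma probability_box_noise d (Omega : measurableType d)
    (P : probability Omega R) (Z : 'I_m -> {RV P >-> R}) g
    (A : 'I_m -> set R) :
  mutually_independent Z -> (forall i, measurable_fun setT (g i)) ->
  (forall i, measurable (A i)) ->
  (P ((fun w => [tuple g i (Z i w) | i < m]) @^-1` box A) =
   \prod_(i < m) distribution P (Z i) (g i @^-1` A i))%E.
Proof.
move=> indZ mg mA.
have mgA i : measurable (g i @^-1` A i).
  by rewrite -[X in measurable X]setTI; exact: mg.
transitivity (\prod_(i in finset.setT) distribution P (Z i) (g i @^-1` A i))%E.
  rewrite -indZ//; congr (P _); apply/seteqP; split => w /= gA i.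
    by move=> _; have := gA i; rewrite tnth_mktuple.
  by rewrite tnth_mktuple; apply: gA; rewrite /= finset.in_setT.
by apply: eq_bigl => i; rewrite finset.in_setT.
Qed.

(** Independence turns the probability of a box into a product of marginals, so equal marginals give
    equal joint laws, even for noises living on different probability spaces. *)
Lemma eq_law_tuple_noise d (Omega : measurableType d)
    (P : probability Omega R) (Z : 'I_m -> {RV P >-> R})
    d' (Omega' : measurableType d') (P' : probability Omega' R)
    (Z' : 'I_m -> {RV P' >-> R}) g (g' : 'I_m -> R -> R) :
  mutually_independent Z -> mutually_independent Z' ->
  (forall i, measurable_fun setT (g i)) ->
  (forall i, measurable_fun setT (g' i)) ->
  (forall i A, measurable A ->
    distribution P (Z i) (g i @^-1` A) =
    distribution P' (Z' i) (g' i @^-1` A)) ->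
  forall O, measurable O ->
  P ((fun w => [tuple g i (Z i w) | i < m]) @^-1` O) =
  P' ((fun w => [tuple g' i (Z' i w) | i < m]) @^-1` O).
Proof.
move=> iZ iZ' mg mg' gg' O mO.
pose W : {RV P >-> m.-tuple R} :=
  mfun_Sub (mem_set (measurable_tuple_noise Z mg)).
pose W' : {RV P' >-> m.-tuple R} :=
  mfun_Sub (mem_set (measurable_tuple_noise Z' mg')).
apply: (@measure_tuple_unique _ _ _ _ (distribution P W) (distribution P' W'))
  => // A mA.
apply: etrans (probability_box_noise iZ mg mA) _.
apply: etrans _ (esym (probability_box_noise iZ' mg' mA)).
by apply: eq_bigr => i _; exact: gg'.
Qed.

End independent_noise.

Lemma sum_sqr_sensitivity (R : realType) (X : Type) (c : record_change)
    (m : nat) (f : dataset X -> m.-tuple R) (sigma : 'I_m -> R) (r : R)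
    (D D' : dataset X) :
  (forall i, 0 < sigma i) ->
  (\sum_(i < m) coord_sensitivity c f i ^+ 2 / (sigma i ^+ 2)%:E <= r%:E)%E ->
  neighbors c D D' ->
  \sum_(i < m) ((tnth (f D) i - tnth (f D') i) / sigma i) ^+ 2 <= r.
Proof.
move=> s0 hr DD'; rewrite -lee_fin; apply: le_trans hr.
rewrite -sumEFin; apply: lee_sum => i _.
have s2 : sigma i ^+ 2 != 0 by rewrite gt_eqF// exprn_gt0.
rewrite inver (negbTE s2) exprMn exprVn EFinM lee_wpmul2r//.
  by rewrite lee_fin invr_ge0 sqr_ge0.
(* Squaring is monotone on nonnegative extended reals; the sensitivity is nonnegative because [0]
   belongs to the set whose supremum it is. *)
rewrite -real_normK ?num_real// EFin_expe lee_sqr//.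
- by apply: ereal_sup_ubound; right; exists D, D'.
- by apply: ereal_sup_ubound; left.
Qed.


Theorem lemma1 (R : realType) (X : Type) (c : record_change) (m : nat)
    (epsilon delta : R)
    (d : measure_display) (Omega : measurableType d) (P : probability Omega R)
    (sigma_star : R) (hsigma_star : 0 < sigma_star)
    (Z : 'I_m -> {RV P >-> R})
    (hZ : forall i, centered_normal (Z i) sigma_star)
    (hZind : mutually_independent Z)
    (hM : forall f : dataset X -> m.-tuple R,
        (l2_sensitivity c f <= 1)%E ->
        differentially_private P c (additive_mechanism f Z) epsilon delta)
    (d' : measure_display) (Omega' : measurableType d')
    (P' : probability Omega' R)
    (sigma : 'I_m -> R) (hsigma : forall i, 0 < sigma i)
    (Z' : 'I_m -> {RV P' >-> R})
    (hZ' : forall i, centered_normal (Z' i) (sigma i))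
    (hZind' : mutually_independent Z')
    (f' : dataset X -> m.-tuple R)
    (hsum : (\sum_(i < m) coord_sensitivity c f' i ^+ 2 / (sigma i ^+ 2)%:E
             <= (1 / sigma_star ^+ 2)%:E)%E) :
  differentially_private P' c (additive_mechanism f' Z') epsilon delta.
Proof.
pose scale i : R := sigma i / sigma_star.
have scale_gt0 i : 0 < scale i by rewrite divr_gt0.
have sigmaE i : sigma i = scale i * sigma_star by rewrite divfK// gt_eqF.
pose f D := [tuple tnth (f' D) i / scale i | i < m].
have f_sens : (l2_sensitivity c f <= 1)%E.
  apply: ge_ereal_sup => _ [->|[D [D' [DD' ->]]]]; first exact: lee01.
  rewrite lee_fin -[leRHS]sqrtr1 ler_sqrt//.
  have := sum_sqr_sensitivity hsigma hsum DD'.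
  (* Multiplying by [sigma_star ^+ 2] turns each [1 / sigma i] into [1 / scale i], which gives the
     squared distance between the values of [f]. *)
  rewrite ler_pdivlMr ?exprn_gt0// mulr_suml; congr (_ <= _).
  apply: eq_bigr => i _; rewrite !tnth_mktuple -exprMn; congr (_ ^+ 2).
  by rewrite -mulrBl /scale invf_div mulrA mulrAC.
pose T (x : m.-tuple R) : m.-tuple R := [tuple scale i * tnth x i | i < m].
have mT : measurable_fun setT T.
  apply/measurable_fun_tnthP => i.
  rewrite (_ : _ \o _ = *%R (scale i) \o (@tnth m R ^~ i)).
    apply: measurableT_comp; first exact: mulrl_measurable.
    exact: measurable_tnth.
  by apply/funext => x /=; rewrite tnth_mktuple.
have law D O : measurable O ->
    P (additive_mechanism f Z D @^-1` (T @^-1` O)) =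
    P' (additive_mechanism f' Z' D @^-1` O).
  move=> mO.
  (* [T] sends [f D + Z] to [f' D] plus the rescaled noise, so coordinate [i] of the two outputs is
     [g i] of [Z i] and [g' i] of [Z' i]. *)
  pose g i x := tnth (f' D) i + scale i * x.
  pose g' i x := tnth (f' D) i + x.
  have mg i : measurable_fun setT (g i).
    by apply: measurable_funD => //; exact: mulrl_measurable.
  have mg' i : measurable_fun setT (g' i) by exact: measurable_funD.
  rewrite -(eq_law_tuple_noise hZind hZind' mg mg')//.
    congr (P (_ @^-1` O)); apply/funext => w; apply: eq_from_tnth => i.
    by rewrite !tnth_mktuple mulrDr mulrC divfK// gt_eqF.
  move=> i A mA.
  have mgA : measurable (g' i @^-1` A).
    by rewrite -[X in measurable X]setTI; exact: mg'.
  have mgA2 : measurable (g i @^-1` A).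
    by rewrite -[X in measurable X]setTI; exact: mg.
  (* Since [g i] is [g' i] after multiplication by [scale i], the marginals agree by dilation of the
     normal law. *)
  by rewrite hZ ?hZ'// sigmaE normal_prob_dilation// gt_eqF//.
move=> D D' DD' O mO; rewrite -!law//; apply: hM => //.
by rewrite -[X in measurable X]setTI; exact: mT.
Qed.
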